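(* Let $\{S(t)\}_{t\ge 0}$ be a dissipative dynamical system on a complete metric space $(X,d)$ and let $\mathcal{B}_0\subseteq X$ be a positively invariant bounded absorbing set. Assume that there exist $\beta\in(0,1)$, positive constants $C,T$, a positive integer $m$, functions $g_l:(\mathbb{R}^+)^m\to\mathbb{R}^+$ ($l=1,2$), functions $\Psi_r:X\times X\to\mathbb{R}^+$ ($r=1,2$) and pseudometrics $\varrho_T^i$ ($i=1,2,\ldots,m$) on $\mathcal{B}_0$ such that: (i) for $l=1,2$, $g_l$ is non-decreasing with respect to each variable, $g_l(0,\ldots,0)=0$, and $g_l$ is continuous at $(0,\ldots,0)$; (ii) for $i=1,\ldots,m$, $\varrho_T^i$ is precompact on $\mathcal{B}_0$, i.e. any sequence $\{x_n\}\subseteq\mathcal{B}_0$ has a subsequence $\{x_{n_k}\}$ which is Cauchy with respect to $\varrho_T^i$; (iii) $\Psi_r\in\mathrm{Contr}(\mathcal{B}_0)$ for $r=1,2$; (iv) for all $y_1,y_2\in\mathcal{B}_0$, $$\big(d(S(T)y_1,S(T)y_2)\big)^2\le \big(d(y_1,y_2)\big)^2+g_1\big(\varrho_T^1(y_1,y_2),\ldots,\varrho_T^m(y_1,y_2)\big)+\Psi_1(y_1,y_2)$$ and $$\big(d(S(T)y_1,S(T)y_2)\big)^2\le C\Big[\big(d(y_1,y_2)\big)^2-\big(d(S(T)y_1,S(T)y_2)\big)^2+g_1\big(\varrho_T^1(y_1,y_2),\ldots,\varrho_T^m(y_1,y_2)\big)+\Psi_1(y_1,y_2)\Big]^{\beta}+g_2\big(\varrho_T^1(y_1,y_2),\ldots,\varrho_T^m(y_1,y_2)\big)+\Psi_2(y_1,y_2).$$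 Then there exists $N_0\in\mathbb{N}$ such that $$\alpha(S(t)\mathcal{B}_0)\le 2\Big[\Big(\frac{t}{T}-N_0-1\Big)\Big(\frac1\beta-1\Big)(1+3C)^{-\frac1\beta}+\big(\alpha(\mathcal{B}_0)\big)^{\frac{2(\beta-1)}{\beta}}\Big]^{\frac{\beta}{2(\beta-1)}},\qquad \forall t\ge (N_0+1)T.$$ Thus $(X,\{S(t)\}_{t\ge0})$ possesses a generalized polynomial attractor $\mathcal{A}^*$, and for each bounded subset $B$ of $X$, $$\mathrm{dist}\big(S(t)B,\mathcal{A}^*\big)\le 2\Big[\Big(\frac{t-t_*(B)-1}{T}-N_0-1\Big)\Big(\frac1\beta-1\Big)(1+3C)^{-\frac1\beta}+\big(\alpha(\mathcal{B}_0)\big)^{\frac{2(\beta-1)}{\beta}}\Big]^{\frac{\beta}{2(\beta-1)}},\qquad \forall t\ge (N_0+1)T+t_*(B)+1,$$ where $t_*(B)$ is the entering time of $B$ into $\mathcal{B}_0$.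
   Context: $\mathbb{R}^+=[0,\infty)$. Dynamical system: $(X,\{S(t)\}_{t\ge0})$ is understood in the usual sense: $S(t):X\to X$ is continuous for each $t\ge0$, $S(0)=\mathrm{Id}$, $S(t+s)=S(t)S(s)$ for all $t,s\ge 0$, and $t\mapsto S(t)x$ is continuous for each $x\in X$. A set $\mathcal{B}_0$ is absorbing if for every bounded $B\subseteq X$ there is a time $t_*(B)\ge0$ (the entering time of $B$ into $\mathcal{B}_0$) such that $S(t)B\subseteq\mathcal{B}_0$ for all $t\ge t_*(B)$. The system is dissipative if it has a bounded absorbing set. A set $A$ is positively invariant if $S(t)A\subseteq A$ for all $t\ge0$. Noncompactness measure: for bounded $B\subseteq X$, $\alpha(B)$ is the (Kuratowski) measure of noncompactness, i.e. the infimum of all $\delta>0$ such that $B$ has a finite cover by sets of diameter less than $\delta$. If $\alpha(\mathcal{B}_0)=0$, the negative power $(\alpha(\mathcal{B}_0))^{2(\beta-1)/\beta}$ is read as $+\infty$ and the right-hand sides of the two estimates are read as $0$. Semidistance: $\mathrm{dist}(A,B)=\sup_{a\in A}\inf_{b\in B}d(a,b)$. Contractive functions: for bounded $B\subseteq X$, a function $\Psi:X\times X\to\mathbb{R}^+$ is contractive on $B\times B$ if every sequence $\{y_n\}\subseteq B$ has a subsequence $\{y_{n_k}\}$ with $\lim_{k\to\infty}\lim_{l\to\infty}\Psi(y_{n_k},y_{n_l})=0$. $\mathrm{Contr}(B)$ denotes the set of all contractive functions on $B\times B$. Generalized attractors: let $\varphi:\mathbb{R}^+\to\mathbb{R}^+$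 satisfy $\varphi(t)\to0$ as $t\to+\infty$. A compact set $\mathcal{A}^*\subseteq X$ is a generalized $\varphi$-attractor for $(X,\{S(t)\}_{t\ge0})$ iff $\mathcal{A}^*$ is positively invariant with respect to $S(t)$ and there exists $t_0\in\mathbb{R}$ such that for every bounded set $B\subseteq X$ there exists $t_B\ge0$ such that $\mathrm{dist}(S(t)B,\mathcal{A}^* )\le\varphi(t+t_0-t_B)$ for all $t\ge t_B$. If $\varphi(t)=C't^{-\beta'}$ for certain positive constants $C',\beta'$, then $\mathcal{A}^*$ is called a generalized polynomial attractor. *)

(* Defs.v *)
From HB Require Import structures.
From mathcomp Require Import all_boot all_order all_algebra.
From mathcomp Require Import all_classical all_reals all_analysis.

Set Implicit Arguments.
Unset Strict Implicit.
Unset Printing Implicit Defensive.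

Import Order.TTheory GRing.Theory Num.Theory.
Import numFieldNormedType.Exports.

Local Open Scope classical_set_scope.
Local Open Scope ring_scope.

Section MetricNotions.
Context {R : realType} {X : metricType R}.
Implicit Types (A B U : set X).

(* The library's [completeType] forces the space to be pointed, so completeness
   is kept as a predicate, which does not exclude the empty space. *)
Definition complete_metric : Prop :=
  forall u : nat -> X, cauchy (u @ \oo) -> exists x : X, u @ \oo --> x.

Definition metric_bounded B : Prop :=
  exists M : R, forall x y, B x -> B y -> mdist x y <= M.

(* An empty set has diameter -oo here instead of 0; this is immaterial, since
   diameters are only compared with positive numbers. *)
Definition diameter U : \bar R :=
  ereal_sup [set (mdist p.1 p.2)%:E | p in U `*` U].

(* [inf] is the infimum in R, which is the intended one when [B] is bounded. *)
Definition kuratowski B : R :=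
  inf [set delta : R | 0 < delta /\
    exists F : set (set X), [/\ finite_set F,
      B `<=` \bigcup_(U in F) U &
      forall U, F U -> (diameter U < delta%:E)%E]].

(* The value is -oo (instead of 0) if [A] is empty, and +oo if only [B] is. *)
Definition semidist A B : \bar R :=
  ereal_sup [set ereal_inf [set (mdist a b)%:E | b in B] | a in A].

Definition pseudometric_on B (rho : X -> X -> R) : Prop :=
  [/\ forall x y, B x -> B y -> 0 <= rho x y,
      forall x, B x -> rho x x = 0,
      forall x y, B x -> B y -> rho x y = rho y x &
      forall x y z, B x -> B y -> B z -> rho x z <= rho x y + rho y z].

Definition precompact_on B (rho : X -> X -> R) : Prop :=
  forall x : nat -> X, (forall n, B (x n)) ->
  exists2 n : nat -> nat, increasing_seq n &
    forall e : R, 0 < e -> exists N : nat, forall k l : nat,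
      (N <= k)%N -> (N <= l)%N -> rho (x (n k)) (x (n l)) < e.

Definition Contr B : set (X -> X -> R) :=
  [set Psi : X -> X -> R | (forall x y, 0 <= Psi x y) /\
    forall y : nat -> X, (forall n, B (y n)) ->
    exists n : nat -> nat, [/\ increasing_seq n,
      forall k, cvgn (fun l => Psi (y (n k)) (y (n l))) &
      (fun k => limn (fun l => Psi (y (n k)) (y (n l)))) @ \oo --> (0 : R)]].

End MetricNotions.
Arguments complete_metric {R} X.

Section DynamicalSystems.
Context {R : realType} {X : metricType R}.
Implicit Types (S : R -> X -> X) (A B : set X).

(* The time parameter ranges over R; only nonnegative times are meaningful. *)
Record dynamical_system S : Prop := DynamicalSystem {
  ds_continuous : forall t, 0 <= t -> continuous (S t) ;
  ds_id : forall x, S 0 x = x ;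
  ds_semigroup : forall t s, 0 <= t -> 0 <= s ->
    forall x, S (t + s) x = S t (S s x) ;
  ds_time_continuous : forall x,
    {within [set t : R | 0 <= t], continuous (fun t => S t x)} }.

(* Any such time qualifies, not only a least one. *)
Definition entering_time S A B (tB : R) : Prop :=
  0 <= tB /\ forall t, tB <= t -> S t @` B `<=` A.

Definition absorbing S A : Prop :=
  forall B, metric_bounded B -> exists tB, entering_time S A B tB.

Definition dissipative S : Prop :=
  exists2 A, metric_bounded A & absorbing S A.

Definition positively_invariant S A : Prop :=
  forall t, 0 <= t -> S t @` A `<=` A.

(* Only the values of [phi] on [0, +oo[ matter; hence the requirement that the
   argument of [phi] be nonnegative in the attraction estimate. *)
Definition generalized_attractor S (phi : R -> R) A : Prop :=
  [/\ (forall t, 0 <= t -> 0 <= phi t) /\ phi @ +oo --> (0 : R),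
      compact A,
      positively_invariant S A &
      exists t0 : R, forall B, metric_bounded B ->
        exists2 tB : R, 0 <= tB & forall t, tB <= t ->
          0 <= t + t0 - tB /\
          (semidist (S t @` B) A <= (phi (t + t0 - tB))%:E)%E].

(* [C' * t `^ (- beta')] is infinite at 0, so [phi 0] is left unspecified. *)
Definition generalized_polynomial_attractor S A : Prop :=
  exists C' beta' : R, exists phi : R -> R,
    [/\ 0 < C', 0 < beta',
        forall t, 0 < t -> phi t = C' * t `^ (- beta') &
        generalized_attractor S phi A].

End DynamicalSystems.

Section OrthantFunctions.
Context {R : realType} {m : nat}.

Definition orthant : set 'rV[R]_m := [set v | forall i, 0 <= v ord0 i].

Definition nonneg_on_orthant (g : 'rV[R]_m -> R) : Prop :=
  forall v, orthant v -> 0 <= g v.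

Definition nondecreasing_each_variable (g : 'rV[R]_m -> R) : Prop :=
  forall (i : 'I_m) (u v : 'rV[R]_m), orthant u -> orthant v ->
    (forall j, j != i -> u ord0 j = v ord0 j) ->
    u ord0 i <= v ord0 i -> g u <= g v.

Definition continuous_at_origin (g : 'rV[R]_m -> R) : Prop :=
  g @ within orthant (nbhs (0 : 'rV[R]_m)) --> g 0.

End OrthantFunctions.

Definition eval_pseudometrics {R : realType} {X : metricType R} {m : nat}
    (rho : 'I_m -> X -> X -> R) (x y : X) : 'rV[R]_m :=
  \row_(i < m) rho i x y.

(* The case split implements the convention 0 ^ (2 (beta - 1) / beta) = +oo for
   the negative exponent; the library has [0 `^ r = 0] for r <> 0. *)
Definition decay_bound {R : realType} (beta C T alpha0 : R) (N0 : nat) (t : R)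
    : R :=
  if alpha0 == 0 then 0 else
  2 * ((t / T - N0%:R - 1) * (1 / beta - 1) * (1 + 3 * C) `^ (- (1 / beta))
       + alpha0 `^ (2 * (beta - 1) / beta)) `^ (beta / (2 * (beta - 1))).

(* Main.v *)
(* For [A] let [separation A] be the supremum of the [r] such that [A] contains
   an infinite sequence of points at mutual distance at least [r]; it satisfies
   [separation A <= kuratowski A <= 2 * separation A], whence the factor 2.
   Along a suitable subsequence the pseudometric and contractive terms of both
   inequalities vanish, so [w n := separation (S (n T) B0) ^+ 2] satisfies
   [w n.+1 <= C * (w n - w n.+1) `^ beta]. As [w] converges, there is [N0] with
   [w n - w n.+1 <= 1] for [n >= N0], and then
   [w n <= (1 + C) * (w n - w n.+1) `^ beta]; hence [w n `^ (1 - 1 / beta)]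
   grows at least linearly. The attractor is the closure of the union of the
   orbits of finite nets of the sets [S (n T) B0], [n > N0], taken at the scale
   of the decay bound; if [kuratowski B0 = 0], the closure of [B0] will do. *)
Require Import Defs.
From mathcomp Require Import all_boot all_order all_algebra.
From mathcomp Require Import all_classical all_reals all_analysis.
From mathcomp Require Import ring lra.

Set Implicit Arguments.
Unset Strict Implicit.
Unset Printing Implicit Defensive.

Import Order.TTheory GRing.Theory Num.Theory.
Import numFieldNormedType.Exports.

Local Open Scope classical_set_scope.
Local Open Scope ring_scope.

(** * Greedy construction of sequences *)

(** Remembering the whole list of earlier choices lets each new term be related by [Q] to all of
    them, not just to its predecessor. *)
Lemma greedy_seq (V : eqType) (P : V -> Prop) (Q : V -> V -> Prop) :
  (forall s : seq V, (forall y, y \in s -> P y) ->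
    exists2 x, P x & forall y, y \in s -> Q y x) ->
  exists2 u : nat -> V, forall n, P (u n) &
    forall i j, (i < j)%N -> Q (u i) (u j).
Proof.
move=> H.
have /choice[f fP] : forall s : seq V, exists x, (forall y, y \in s -> P y) ->
    P x /\ forall y, y \in s -> Q y x.
  (* The empty list yields a point of [V], the default value of [f] on lists that violate [P]. *)
  have [v _ _] : exists2 x, P x & forall y, y \in [::] -> Q y x by exact: H.
  move=> s; have [sP|nsP] := pselect (forall y, y \in s -> P y).
    by have [x Px Qx] := H s sP; exists x.
  by exists v => /nsP.
(* [L n] lists the first [n] terms, the latest first; term number [n] is [f (L n)]. *)
pose L n := iter n (fun s => f s :: s) [::].
have LP n y : y \in L n -> P y.
  elim: n y => [|n IH] y //=; rewrite in_cons => /orP[/eqP->|]; last exact: IH.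
  by have [] := fP _ IH.
exists (f \o L) => [n|i j] /=; first by have [] := fP _ (LP n).
move=> ij; have [_] := fP _ (LP j); apply.
elim: j ij => // j IH; rewrite ltnS leq_eqVlt in_cons => /orP[/eqP->|/IH ->].
  by rewrite eqxx.
by rewrite orbT.
Qed.

(** Each chosen index [k] satisfies [Q k l] for all large [l], so finitely many earlier choices rule
    out only finitely many candidates. *)
Lemma near_greedy_seq (Q : nat -> nat -> Prop) :
  (\forall k \near \oo, \forall l \near \oo, Q k l) ->
  exists n : nat -> nat, forall i j, (i < j)%N -> Q (n i) (n j).
Proof.
move=> QP; suff [n _ nQ] : exists2 n : nat -> nat,
    forall i, \forall l \near \oo, Q (n i) l &
    forall i j, (i < j)%N -> Q (n i) (n j) by exists n.
apply: (@greedy_seq _ (fun k => \forall l \near \oo, Q k l)) => s sP.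
have sQ : \forall l \near \oo, forall k, k \in s -> Q k l.
  elim: s sP => [|k s IH] sP; first by near=> l.
  have /IH sQ : forall y, y \in s -> \forall l \near \oo, Q y l.
    by move=> y ys; apply: sP; rewrite in_cons ys orbT.
  have kQ : \forall l \near \oo, Q k l by apply: sP; rewrite mem_head.
  near=> l => y; rewrite in_cons => /orP[/eqP->|]; first by near: l.
  by move: y; near: l.
by have [l [? ?]] := filter_ex (filterI QP sQ); exists l.
Unshelve. all: by end_near. Qed.

(** * The separation constant and the Kuratowski measure *)

Section MeasuresOfNoncompactness.
Context {R : realType} {X : metricType R}.
Implicit Types (A B : set X) (r : R).

Definition has_separated_seq A r : Prop :=
  exists2 x : nat -> X, forall n, A (x n) &
    forall i j, (i < j)%N -> r <= mdist (x i) (x j).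

(** The default value 0 of [sup] on the empty set is the right one: that set is empty only for empty
    [A], since a constant sequence is 0-separated. *)
Definition separation A : R := sup [set r | 0 <= r /\ has_separated_seq A r].

Definition finite_net A r : Prop :=
  exists2 s : seq X, forall y, y \in s -> A y &
    forall x, A x -> exists2 y, y \in s & mdist y x < r.

(** If every finite subset of [A] missed some point of [A] by at least [r], greedy choice would
    produce an [r]-separated sequence. *)
Lemma finite_netP A r : ~ has_separated_seq A r -> finite_net A r.
Proof.
move=> nsep; apply: contrapT => nnet; apply: nsep.
apply: (@greedy_seq X A (fun y x => r <= mdist y x)) => s sA.
apply: contrapT => nx; apply: nnet; exists s => // x Ax.
apply: contrapT => ny; apply: nx; exists x => // y ys.
by rewrite leNgt; apply/negP => yx; apply: ny; exists y.
Qed.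

Lemma has_separated_seq_le A r r' :
  r' <= r -> has_separated_seq A r -> has_separated_seq A r'.
Proof.
by move=> rr' [x xA xr]; exists x => // i j /xr; exact: le_trans.
Qed.

Lemma has_separated_seq_sub A B r :
  A `<=` B -> has_separated_seq A r -> has_separated_seq B r.
Proof. by move=> AB [x xA xr]; exists x => // n; exact: AB. Qed.

Lemma metric_boundedS A B : A `<=` B -> metric_bounded B -> metric_bounded A.
Proof. by move=> AB [M BM]; exists M => x y /AB ? /AB; exact: BM. Qed.

Lemma separation_ub A : metric_bounded A ->
  has_ubound [set r | 0 <= r /\ has_separated_seq A r].
Proof.
move=> [M AM]; exists M => r /= [_ [x xA xr]].
by apply: (le_trans (xr 0%N 1%N isT)); exact: AM.
Qed.

Lemma separation_ge0 A : metric_bounded A -> 0 <= separation A.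
Proof.
move=> bA; have [[r rA]|] :=
    pselect ([set r | 0 <= r /\ has_separated_seq A r] !=set0).
  apply: (le_trans rA.1); exact: (ub_le_sup (separation_ub bA) rA).
by move=> /set0P/negP; rewrite negbK /separation => /eqP ->; rewrite sup0.
Qed.

Lemma separation_gt A r : metric_bounded A ->
  separation A < r -> ~ has_separated_seq A r.
Proof.
move=> bA Ar sr; have r0 : 0 <= r := le_trans (separation_ge0 bA) (ltW Ar).
have /(ub_le_sup (separation_ub bA)) : 0 <= r /\ has_separated_seq A r by [].
by rewrite leNgt Ar.
Qed.

Lemma separation_lt A r : 0 <= r -> r < separation A -> has_separated_seq A r.
Proof.
move=> r0 rA; have ne : [set r | 0 <= r /\ has_separated_seq A r] !=set0.
  apply/set0P/negP => /eqP E; move: rA.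
  by rewrite /separation E sup0 ltNge r0.
have [s [_ sA] rs] := sup_gt ne rA.
exact: has_separated_seq_le (ltW rs) sA.
Qed.

Lemma separationS A B : A `<=` B -> metric_bounded B ->
  separation A <= separation B.
Proof.
move=> AB bB; rewrite leNgt; apply/negP => BA.
have bA := metric_boundedS AB bB.
pose r := (separation A + separation B) / 2.
have Br : separation B < r by rewrite /r; lra.
have rA : r < separation A by rewrite /r; lra.
apply: (separation_gt bB Br); apply: (has_separated_seq_sub AB).
by apply: separation_lt rA; apply: le_trans (ltW Br); exact: separation_ge0.
Qed.

Lemma kuratowski_lb A : has_lbound [set delta : R | 0 < delta /\
    exists F : set (set X), [/\ finite_set F,
      A `<=` \bigcup_(U in F) U &
      forall U, F U -> (diameter U < delta%:E)%E]].
Proof. by exists 0 => r /= [/ltW]. Qed.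

Lemma diameter_le A r : (forall x y, A x -> A y -> mdist x y <= r) ->
  (diameter A <= r%:E)%E.
Proof.
move=> Ar; apply: ge_ereal_sup => _ [[x y] [/= Ax Ay] <-].
by rewrite lee_fin Ar.
Qed.

Lemma le_diameter A x y : A x -> A y -> ((mdist x y)%:E <= diameter A)%E.
Proof. by move=> Ax Ay; apply: ereal_sup_ubound; exists (x, y). Qed.

Lemma kuratowski_neq0 A : metric_bounded A -> [set delta : R | 0 < delta /\
    exists F : set (set X), [/\ finite_set F,
      A `<=` \bigcup_(U in F) U &
      forall U, F U -> (diameter U < delta%:E)%E]] !=set0.
Proof.
move=> [M AM]; exists (`|M| + 1); split; first by rewrite ltr_wpDl.
exists [set A]; split; first exact: finite_set1.
  by move=> x Ax; exists A.
move=> _ ->; apply: le_lt_trans (diameter_le AM) _; rewrite lte_fin.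
by rewrite (le_lt_trans (ler_norm M))// ltrDl.
Qed.

Lemma kuratowski_ge0 A : metric_bounded A -> 0 <= kuratowski A.
Proof.
by move=> bA; apply: lb_le_inf (kuratowski_neq0 bA) _ => d [/ltW].
Qed.

Lemma kuratowski_lt_cover A r : metric_bounded A -> kuratowski A < r ->
  exists F : set (set X), [/\ finite_set F, A `<=` \bigcup_(U in F) U &
    forall U, F U -> (diameter U < r%:E)%E].
Proof.
move=> bA /(inf_lt (kuratowski_neq0 bA))[d [d0 [F [fF AF Fd]]] dr].
by exists F; split=> // U /Fd /lt_trans; apply; rewrite lte_fin.
Qed.

Lemma kuratowski_le A r : 0 < r -> (exists F : set (set X),
    [/\ finite_set F, A `<=` \bigcup_(U in F) U &
    forall U, F U -> (diameter U < r%:E)%E]) -> kuratowski A <= r.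
Proof. by move=> r0 ?; apply: ge_inf; first exact: kuratowski_lb. Qed.

Lemma kuratowskiS A B : A `<=` B -> metric_bounded B ->
  kuratowski A <= kuratowski B.
Proof.
move=> AB bB; apply/ler_addgt0Pr => e e0.
have Be : kuratowski B < kuratowski B + e by rewrite ltrDl.
apply: kuratowski_le; first by apply: ltr_wpDl => //; exact: kuratowski_ge0.
have [F [fF BF Fe]] := kuratowski_lt_cover bB Be.
by exists F; split=> //; exact: subset_trans BF.
Qed.

(** Pigeonhole: an [r]-separated sequence has at most one term in each set of diameter less than
    [r], so finitely many such sets cannot cover it. *)
Lemma separation_le_kuratowski A : metric_bounded A ->
  separation A <= kuratowski A.
Proof.
move=> bA; rewrite leNgt; apply/negP => kA.
pose r := (kuratowski A + separation A) / 2.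
have kr : kuratowski A < r by rewrite /r; lra.
have rA : r < separation A by rewrite /r; lra.
have [F [fF AF Fr]] := kuratowski_lt_cover bA kr.
have r0 : 0 <= r := le_trans (kuratowski_ge0 bA) (ltW kr).
have [x xA xr] := separation_lt r0 rA.
have /choice[U UP] : forall n, exists U, F U /\ U (x n).
  by move=> n; have [U FU Ux] := AF _ (xA n); exists U.
have Uneq i j : (i < j)%N -> U i <> U j.
  move=> ij Uij; have := Fr _ (UP i).1; apply/negP; rewrite -leNgt.
  have Uj : U i (x j) by rewrite Uij; exact: (UP j).2.
  by apply: le_trans (le_diameter (UP i).2 Uj); rewrite lee_fin xr.
apply: infinite_nat; have /eq_finite_set <- : (U @` setT #= [set: nat])%card.
  apply: inj_card_eq => i j _ _ Uij.
  by have [/Uneq|/Uneq/nesym|] := ltngtP i j.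
by apply: sub_finite_set fF => _ [n _ <-]; exact: (UP n).1.
Qed.

(** For [r] slightly above the separation constant there is a finite [r]-net, and balls of radius
    [r] have diameter at most [2 * r]. *)
Lemma kuratowski_le_separation A : metric_bounded A ->
  kuratowski A <= 2 * separation A.
Proof.
move=> bA; apply/ler_addgt0Pr => e e0; have s0 := separation_ge0 bA.
(* Doubling turns [e / 4] into [e / 2], which keeps the diameters strictly below the required
   [2 * separation A + e]. *)
pose r := separation A + e / 4.
have /(separation_gt bA)/finite_netP[s _ sr] : separation A < r.
  by rewrite /r; lra.
apply: kuratowski_le; first by lra.
exists [set [set x | mdist y x < r] | y in [set` s]]; split.
- by apply: finite_image; exact: finite_seq.
- by move=> x /sr[y ys yx]; exists [set x | mdist y x < r] => //; exists y.
- move=> _ [y _ <-]; apply: (@le_lt_trans _ _ (r + r)%:E); last first.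
    by rewrite lte_fin /r; lra.
  apply: diameter_le => u v /= yu yv.
  apply: le_trans (metric_triangle _ y _) _.
  by rewrite metric_sym lerD// ltW.
Qed.

End MeasuresOfNoncompactness.

(** * Total boundedness and compactness *)

Section TotallyBoundedSets.
Context {R : realType} {X : metricType R}.
Implicit Types (A B : set X) (r : R).

(** Unlike in [finite_net], the centres may lie outside [A], so the property passes to subsets. *)
Definition covered_by_balls A r : Prop :=
  exists s : seq X, forall x, A x -> exists2 y, y \in s & mdist y x < r.

Definition totally_bounded A : Prop := forall r, 0 < r -> covered_by_balls A r.

Lemma finite_net_covered A r : finite_net A r -> covered_by_balls A r.
Proof. by move=> [s _ sP]; exists s. Qed.

Lemma covered_by_ballsS A B r r' : A `<=` B -> r <= r' ->
  covered_by_balls B r -> covered_by_balls A r'.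
Proof.
move=> AB rr' [s sB]; exists s => x /AB/sB[y ys yx]; exists y => //.
exact: lt_le_trans rr'.
Qed.

Lemma covered_by_ballsU A B r : covered_by_balls A r -> covered_by_balls B r ->
  covered_by_balls (A `|` B) r.
Proof.
move=> [s sA] [s' sB]; exists (s ++ s').
move=> x [/sA|/sB] [y ys yx]; exists y => //;
  by rewrite mem_cat ys ?orbT.
Qed.

Lemma covered_by_balls_bigcup (V : eqType) (s : seq V) (F : V -> set X) r :
  (forall i, i \in s -> covered_by_balls (F i) r) ->
  covered_by_balls (\bigcup_(i in [set` s]) F i) r.
Proof.
elim: s => [|i s IH] sF; first by exists [::] => x [].
have /IH Fs : forall j, j \in s -> covered_by_balls (F j) r.
  by move=> j js; apply: sF; rewrite in_cons js orbT.
apply: covered_by_ballsS (lexx r) (covered_by_ballsU (sF i (mem_head _ _)) Fs).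
move=> x [j /=]; rewrite in_cons => /orP[/eqP->|js Fx]; first by left.
by right; exists j.
Qed.

(** A separated sequence would have a cluster point, whose ball of radius [r / 2] would contain two
    terms with different indices. *)
Lemma compact_totally_bounded A : compact A -> totally_bounded A.
Proof.
move=> cA r r0; apply/finite_net_covered/finite_netP => -[x xA xr].
have r20 : 0 < r / 2 by rewrite divr_gt0.
have [|p [Ap clp]] := cA (x @ \oo) _.
  by exists 0%N => // n _; exact: xA.
have nball : nbhs p [set y | mdist p y < r / 2].
  by rewrite -ballEmdist; exact: nbhsx_ballx.
have later N : exists2 n, (N <= n)%N & mdist p (x n) < r / 2.
  have /clp/(_ nball)[_ [[n /= Nn <-] pn]] :
      (x @ \oo) [set x n | n in [set n | (N <= n)%N]].
    by exists N => // n Nn; exists n.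
  by exists n.
have [n _ pn] := later 0%N; have [k nk pk] := later n.+1.
have := xr _ _ nk; apply/negP; rewrite -ltNge.
apply: le_lt_trans (metric_triangle _ p _) _.
by rewrite [ltRHS]splitr ltrD// metric_sym.
Qed.

Lemma totally_bounded_closure A :
  totally_bounded A -> totally_bounded (closure A).
Proof.
move=> tA r r0; have r20 : 0 < r / 2 by rewrite divr_gt0.
have [s sA] := tA _ r20; exists s => x.
move=> /(_ (ball x (r / 2)) (nbhsx_ballx _ _ r20))[a [/sA[y ys ya]]].
rewrite ballEmdist /= => xa; exists y => //.
apply: le_lt_trans (metric_triangle _ a _) _.
by rewrite [ltRHS]splitr ltrD// metric_sym.
Qed.

(** An ultrafilter that contains a finite union contains one of its members; the induction removes
    from [A] one ball not in [F] at a time, so the rest still belongs to [F]. *)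
Lemma ultra_covered_by_balls (F : set_system X) A r : UltraFilter F -> F A ->
  covered_by_balls A r -> exists y, F [set x | mdist y x < r].
Proof.
move=> FU FA [s]; elim: s A FA => [|y s IH] A FA sA.
  by have /filter_ex[x /sA[]] := FA.
have [Fy|Fy] := in_ultra_setVsetC [set x | mdist y x < r] FU.
  by exists y.
apply: (IH (A `&` ~` [set x | mdist y x < r])); first exact: filterI.
move=> x [/sA[z]]; rewrite in_cons => /orP[/eqP-> //|zs zx _].
by exists z.
Qed.

(** Compactness is tested on ultrafilters. [F] contains a ball of each radius [harmonic n]; any two
    members of [F] meet, so the centres form a Cauchy sequence, and [F] converges to their limit. *)
Lemma complete_totally_bounded_compact A : complete_metric X ->
  totally_bounded A -> compact (closure A).
Proof.
move=> Xc /totally_bounded_closure tA; rewrite compact_ultra => F FU FA.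
have FP : ProperFilter F by exact: ultra_proper.
have /choice[u uF] : forall n, exists y, F [set x | mdist y x < harmonic n].
  by move=> n; apply: ultra_covered_by_balls FA (tA _ (harmonic_gt0 n)).
have small e : 0 < e -> \forall n \near \oo, @harmonic R n < e.
  move=> e0; have /cvgrPdist_lt/(_ _ e0) := @cvg_harmonic R.
  by apply: filterS => n; rewrite sub0r normrN ger0_norm ?harmonic_ge0.
have [x ux] : exists x : X, u @ \oo --> x.
  apply/Xc/cauchy_exP => e e0.
  have e20 : 0 < e / 2 by rewrite divr_gt0.
  have [n ne] := filter_ex (small _ e20); exists (u n).
  apply: filterS (small _ e20) => k ke; rewrite ballEmdist /=.
  have [z [nz kz]] := filter_ex (filterI (uF n) (uF k)).
  apply: le_lt_trans (metric_triangle _ z _) _.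
  by rewrite [ltRHS]splitr ltrD// ?(lt_trans nz)// metric_sym (lt_trans kz).
have Fx : F --> x.
  apply/metricType_numDomainType.fcvgrPdist_lt => e e0.
  have e20 : 0 < e / 2 by rewrite divr_gt0.
  move/metricType_numDomainType.cvgrPdist_lt : ux => /(_ _ e20) ux.
  have [n [nx ne]] := filter_ex (filterI ux (small _ e20)).
  apply: filterS (uF n) => y /= ny.
  apply: le_lt_trans (metric_triangle _ (u n) _) _.
  by rewrite [ltRHS]splitr ltrD// (lt_trans ny).
exists x; split=> //; apply: closed_closure => B /Fx FB.
by have [y] := filter_ex (filterI FA FB); exists y.
Qed.

End TotallyBoundedSets.

(** * Extraction of subsequences with iterated smallness *)

Section DoublyNullSequences.
Context {R : realType} {X : metricType R}.
Implicit Types (B : set X) (f : X -> X -> R) (x y : nat -> X).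

(** A common consequence of the iterated limit for contractive functions and the Cauchy property for
    pseudometrics; the threshold for [l] may depend on [k]. *)
Definition doubly_null f x : Prop := forall e, 0 < e ->
  \forall k \near \oo, \forall l \near \oo, f (x k) (x l) < e.

Definition extractible B f : Prop := forall x, (forall n, B (x n)) ->
  exists2 n : nat -> nat, increasing_seq n & doubly_null f (x \o n).

Lemma increasing_seq_cvg (n : nat -> nat) : increasing_seq n -> n @ \oo --> \oo.
Proof.
move=> nincr; have nk k : (k <= n k)%N.
  elim: k => // k IH; apply: (leq_ltn_trans IH).
  by rewrite ltnNge -leEnat nincr -ltnNge.
move=> P [N _ NP]; exists N => // k /= Nk; apply: NP => /=.
exact: leq_trans (nk k).
Qed.

Lemma doubly_null_comp f x (n : nat -> nat) :
  increasing_seq n -> doubly_null f x -> doubly_null f (x \o n).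
Proof.
move=> /increasing_seq_cvg nc fx e /fx/nc fe.
by apply: (@filterS _ \oo _ _ _ _ fe) => k /nc.
Qed.

Lemma Contr_extractible B f : Contr B f -> extractible B f.
Proof.
move=> [_ fC] x /fC[n [nincr cv lim0]]; exists n => // e e0.
move/cvgrPdist_lt: lim0 => /(_ _ e0) => small.
apply: filterS small => k; rewrite sub0r normrN => /(le_lt_trans (ler_norm _)).
have /cvgr_lt := cv k; exact.
Qed.

Lemma precompact_extractible B f : precompact_on B f -> extractible B f.
Proof.
move=> fP x /fP[n nincr fx]; exists n => // e /fx[N NP].
by exists N => // k Nk; exists N => // l Nl; exact: NP.
Qed.

(** Successive extraction: what an earlier extraction achieved survives the later ones by
    [doubly_null_comp]. *)
Lemma common_extraction B (I : eqType) (F : I -> X -> X -> R) (s : seq I) :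
  (forall i, i \in s -> extractible B (F i)) ->
  forall x, (forall n, B (x n)) ->
  exists2 n : nat -> nat, increasing_seq n &
    forall i, i \in s -> doubly_null (F i) (x \o n).
Proof.
elim: s => [|i s IH] sF x xB; first by exists id.
have [|n nincr nF] := IH _ x xB.
  by move=> j js; apply: sF; rewrite in_cons js orbT.
have [|n' n'incr n'F] := sF i (mem_head _ _) (x \o n); first by move=> k /=.
exists (n \o n') => [k l /=|j]; first by rewrite nincr.
rewrite in_cons => /orP[/eqP->//|/nF]; exact: doubly_null_comp.
Qed.

End DoublyNullSequences.

(** * The recursive inequality for the separation constant *)

Lemma continuous_at_origin_lt {R : realType} (m : nat) (g : 'rV[R]_m -> R) :
  continuous_at_origin g -> forall e, g 0 < e -> exists2 eta : R, 0 < eta &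
    forall v, orthant v -> (forall i, v ord0 i < eta) -> g v < e.
Proof.
move=> /cvgr_lt gc e /gc; rewrite near_withinE => /nbhs_ballP[eta eta0 etag].
exists eta => // v ov vlt; apply: (etag v _ ov); split=> // i j.
by rewrite mxE /ball /= sub0r normrN ord1 ger0_norm; [exact: vlt|exact: ov].
Qed.

Section SeparationStep.
Context {R : realType} {X : metricType R}.
Context (F : X -> X) (B : set X) (beta C : R) (m : nat)
  (g1 g2 : 'rV[R]_m -> R) (Psi1 Psi2 : X -> X -> R) (rho : 'I_m -> X -> X -> R)
  (beta_gt0 : 0 < beta) (C_gt0 : 0 < C)
  (rho_pseudometric : forall i, pseudometric_on B (rho i))
  (g1_0 : g1 0 = 0) (g2_0 : g2 0 = 0)
  (g1_continuous : continuous_at_origin g1)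
  (g2_continuous : continuous_at_origin g2)
  (rho_precompact : forall i, precompact_on B (rho i))
  (Psi1_contr : Contr B Psi1) (Psi2_contr : Contr B Psi2)
  (ineq1 : forall y1 y2, B y1 -> B y2 ->
    mdist (F y1) (F y2) ^+ 2 <=
      mdist y1 y2 ^+ 2 + g1 (eval_pseudometrics rho y1 y2) + Psi1 y1 y2)
  (ineq2 : forall y1 y2, B y1 -> B y2 ->
    mdist (F y1) (F y2) ^+ 2 <=
      C * (mdist y1 y2 ^+ 2 - mdist (F y1) (F y2) ^+ 2
           + g1 (eval_pseudometrics rho y1 y2) + Psi1 y1 y2) `^ beta
      + g2 (eval_pseudometrics rho y1 y2) + Psi2 y1 y2).

Let perturbation1 y1 y2 := g1 (eval_pseudometrics rho y1 y2) + Psi1 y1 y2.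
Let perturbation2 y1 y2 := g2 (eval_pseudometrics rho y1 y2) + Psi2 y1 y2.

(** A single finite index type for the contractive functions and the pseudometrics, so that one
    extraction serves them all. *)
Let extractible_term (i : bool + 'I_m) : X -> X -> R :=
  match i with inl b => if b then Psi1 else Psi2 | inr i => rho i end.

Let orthant_eval y1 y2 : B y1 -> B y2 -> orthant (eval_pseudometrics rho y1 y2).
Proof.
by move=> By1 By2 i; rewrite mxE; have [+ _ _ _] := rho_pseudometric i; apply.
Qed.

Lemma near_perturbations_lt (x : nat -> X) e : (forall n, B (x n)) -> 0 < e ->
  exists2 n : nat -> nat, increasing_seq n &
    \forall k \near \oo, \forall l \near \oo,
      perturbation1 (x (n k)) (x (n l)) < e /\
      perturbation2 (x (n k)) (x (n l)) < e.
Proof.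
move=> xB e0; have e20 : 0 < e / 2 by rewrite divr_gt0.
have [|n nincr nF] := @common_extraction _ _ B _ extractible_term
    (enum {: bool + 'I_m}) _ x xB.
  move=> [[]|i] _ /=; [exact: Contr_extractible|exact: Contr_extractible|].
  exact: precompact_extractible.
exists n => //.
have {}nF i : doubly_null (extractible_term i) (x \o n).
  by apply: nF; rewrite mem_enum.
have [|eta1 eta10 g1lt] := continuous_at_origin_lt g1_continuous (e := e / 2).
  by rewrite g1_0.
have [|eta2 eta20 g2lt] := continuous_at_origin_lt g2_continuous (e := e / 2).
  by rewrite g2_0.
pose eta := Num.min eta1 eta2.
have eta0 : 0 < eta by rewrite lt_min eta10.
have rholt : \forall k \near \oo, \forall l \near \oo,
    forall i, rho i (x (n k)) (x (n l)) < eta.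
  (* Iterated [near] statements commute with finite conjunctions, hence the induction over the list
     of indices. *)
  suff : \forall k \near \oo, \forall l \near \oo, forall i, i \in enum 'I_m ->
      rho i (x (n k)) (x (n l)) < eta.
    apply: filterS => k; apply: filterS => l H i; apply: H.
    by rewrite mem_enum.
  elim: (enum 'I_m) => [|i s IH]; first by near=> k; near=> l.
  have := nF (inr i) _ eta0; apply: filterS2 IH => k; apply: filterS2 => l.
  by move=> sl il j; rewrite in_cons => /orP[/eqP->|/sl].
have P1 := nF (inl true) _ e20.
have P2 := nF (inl false) _ e20.
apply: filterS3 rholt P1 P2 => k; apply: filterS3 => l rl /= P1 P2.
have ev := orthant_eval (xB (n k)) (xB (n l)).
by split; rewrite [ltRHS]splitr ltrD//; [apply: g1lt|apply: g2lt] => // i;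
  rewrite mxE (lt_le_trans (rl i))// /eta ge_min lexx ?orbT.
Unshelve. all: by end_near. Qed.

(* If the bound failed, then every late pair of a suitable subsequence would be
   at distance at least [r], and a greedy choice would give an [r]-separated
   sequence in [A]. *)
Lemma separated_image_step (A : set X) (r delta e : R) : A `<=` B ->
  0 <= delta -> 0 < e -> has_separated_seq (F @` A) delta ->
  ~ has_separated_seq A r ->
  delta ^+ 2 <= C * (r ^+ 2 - delta ^+ 2 + e) `^ beta + e.
Proof.
move=> AB delta0 e0 [Fx FxA Fxdelta] nr; rewrite leNgt; apply/negP => contra.
have /choice[x /all_and2[xA xF]] : forall n, exists x, A x /\ F x = Fx n.
  by move=> n; have [x Ax Fxn] := FxA n; exists x.
have xB n : B (x n) := AB _ (xA n).
have [n nincr small] := near_perturbations_lt xB e0.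
suff /near_greedy_seq[k kr] : \forall k \near \oo, \forall l \near \oo,
    r <= mdist (x (n k)) (x (n l)).
  by apply: nr; exists (x \o n \o k) => // i; exact: xA.
apply: filterS small => k small; near=> l.
rewrite leNgt; apply/negP => dr.
have [g1e g2e] : perturbation1 (x (n k)) (x (n l)) < e /\
    perturbation2 (x (n k)) (x (n l)) < e by near: l.
rewrite /perturbation1 /perturbation2 in g1e g2e.
(* The separation of [Fx] is stated for ordered indices only, so [l] has to be taken beyond [k]. *)
have nkl : (n k < n l)%N.
  rewrite ltnNge -leEnat nincr -ltnNge; near: l; exact: nbhs_infty_gt.
have := Fxdelta _ _ nkl; rewrite -!xF => dF.
have d0 := mdist_ge0 (x (n k)) (x (n l)).
have {}dF : delta ^+ 2 <= mdist (F (x (n k))) (F (x (n l))) ^+ 2.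
  by rewrite ler_sqr ?nnegrE// (le_trans delta0).
have {}dr : mdist (x (n k)) (x (n l)) ^+ 2 <= r ^+ 2.
  by rewrite ler_sqr ?nnegrE ?(ltW dr)// (le_trans d0)// ltW.
have I1 := ineq1 (xB (n k)) (xB (n l)).
have I2 := ineq2 (xB (n k)) (xB (n l)).
move: I1 I2; set a := _ `^ beta => I1 I2.
(* This is where [ineq1] enters: it makes the base of the power in [ineq2] nonnegative, where the
   power is monotone. *)
have : a <= (r ^+ 2 - delta ^+ 2 + e) `^ beta.
  apply: ge0_ler_powR; rewrite ?nnegrE ?(ltW beta_gt0)//.
    lra.
    clear a I2; lra.
    clear a I2; lra.
rewrite -(ler_pM2l C_gt0) => I3.
move: contra; apply/negP; rewrite -leNgt; lra.
Unshelve. all: by end_near. Qed.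

(** [separated_image_step] is applied at [I' - e] and [I + e], since the suprema need not be
    attained; a small [e] then contradicts the failure of the limiting inequality. *)
Lemma separation_image_step (A : set X) : A `<=` B -> metric_bounded A ->
  F @` A `<=` A ->
  separation (F @` A) ^+ 2 <=
    C * (separation A ^+ 2 - separation (F @` A) ^+ 2) `^ beta.
Proof.
move=> AB bA FAA; have bFA := metric_boundedS FAA bA.
have := separationS FAA bA.
have := separation_ge0 bFA.
set I' := separation (F @` A); set I := separation A => I'0 I'I.
have [->|I'neq0] := eqVneq I' 0.
  by rewrite expr0n mulr_ge0 ?powR_ge0 ?ltW.
have {}I'0 : 0 < I' by rewrite lt_neqAle eq_sym I'neq0.
have D0 : 0 <= I ^+ 2 - I' ^+ 2 by rewrite subr_ge0 ler_sqr ?nnegrE; lra.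
rewrite leNgt; apply/negP => contra.
(* [w] is the midpoint of the two sides of the failing inequality, and [D] is the number whose
   [beta]-th power times [C] equals [w]. The gaps around [w] leave room for [e]. *)
pose w := (I' ^+ 2 + C * (I ^+ 2 - I' ^+ 2) `^ beta) / 2.
pose D := (w / C) `^ beta^-1.
have w0 : 0 <= w.
  by rewrite /w divr_ge0// addr_ge0 ?sqr_ge0// mulr_ge0 ?powR_ge0// ltW.
have Dw : C * D `^ beta = w.
  rewrite /D -powRrM mulVf ?gt_eqF// powRr1 ?(divr_ge0 w0 (ltW C_gt0))//.
  by rewrite mulrCA divff ?mulr1 ?gt_eqF.
have DD : I ^+ 2 - I' ^+ 2 < D.
  rewrite ltNge; apply/negP => DI.
  have : D `^ beta <= (I ^+ 2 - I' ^+ 2) `^ beta.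
    by apply: ge0_ler_powR; rewrite ?nnegrE ?powR_ge0// ltW.
  by rewrite -(ler_pM2l C_gt0) Dw /w; lra.
have [e [e0 eI' eD ew]] : exists e, [/\ 0 < e, e < I',
    (I + e) ^+ 2 - (I' - e) ^+ 2 + e < D & w + e < (I' - e) ^+ 2].
  suff : \forall e \near 0^'+, [/\ 0 < e, e < I',
    (I + e) ^+ 2 - (I' - e) ^+ 2 + e < D & w + e < (I' - e) ^+ 2].
    by move=> /filter_ex.
  near=> e; split.
  - by near: e; exact: nbhs_right_gt.
  - by near: e; exact: nbhs_right_lt.
  (* The squares of [e] cancel: the left-hand side exceeds [I ^+ 2 - I' ^+ 2] by exactly
     [e * (2 * (I + I') + 1)]. *)
  - have : e < (D - (I ^+ 2 - I' ^+ 2)) / (2 * (I + I') + 1).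
      by near: e; apply: nbhs_right_lt; apply: divr_gt0; lra.
    by rewrite ltr_pdivlMr; [nra|lra].
  - have : e < (I' ^+ 2 - w) / (2 * I' + 1).
      by near: e; apply: nbhs_right_lt; apply: divr_gt0; rewrite /w; lra.
    by rewrite ltr_pdivlMr; [nra|lra].
have sI' : has_separated_seq (F @` A) (I' - e).
  by apply: separation_lt; rewrite -/I'; lra.
have sI : ~ has_separated_seq A (I + e).
  by apply: separation_gt; rewrite // -/I; lra.
have I'e : 0 <= I' - e by lra.
have := separated_image_step AB I'e e0 sI' sI.
apply/negP; rewrite -ltNge; apply: le_lt_trans ew.
rewrite lerD2r -Dw ler_pM2l//.
apply: ge0_ler_powR; rewrite ?nnegrE ?powR_ge0 ?ltW//.
have : (I' - e) ^+ 2 <= (I + e) ^+ 2 by rewrite ler_sqr ?nnegrE; lra.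
lra.
Unshelve. all: by end_near. Qed.

End SeparationStep.

(** * Polynomial decay from the recursive inequality *)

Section PolynomialDecay.
Context {R : realType}.
Implicit Types (beta C T : R).

Lemma powRN_le (x y r : R) : 0 < x -> x <= y -> 0 <= r ->
  y `^ (- r) <= x `^ (- r).
Proof.
move=> x0 xy r0; have y0 := lt_le_trans x0 xy.
rewrite !powRN lef_pV2 ?posrE ?powR_gt0//.
by apply: ge0_ler_powR; rewrite ?nnegrE// ltW.
Qed.

(* [(x / y) `^ (- q) = expR (- q * ln (x / y))], and both [expR] and [- ln]
   lie above their tangents. *)
Lemma powRN_tangent (x y q : R) : 0 < x -> 0 < y -> 0 <= q ->
  y `^ (- q) + q * y `^ (- (q + 1)) * (y - x) <= x `^ (- q).
Proof.
move=> x0 y0 q0; pose t := x / y.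
have t0 : 0 < t by rewrite divr_gt0.
have -> : x = t * y by rewrite /t mulfVK ?gt_eqF.
have lnt : ln t <= t - 1.
  have := @le_ln1Dx _ (t - 1); rewrite (_ : 1 + (t - 1) = t); last by ring.
  by apply; lra.
have tq : 1 + q * (1 - t) <= t `^ (- q).
  rewrite /powR gt_eqF//; apply: le_trans (expR_ge1Dx _); nra.
rewrite [leRHS]powRM ?(ltW t0) ?(ltW y0)// opprD powRD; last first.
  by rewrite (gt_eqF y0) implybT.
rewrite powR_inv1 ?(ltW y0)//.
have yq := powR_gt0 (- q) y0.
have -> : y `^ (- q) + q * (y `^ (- q) * y^-1) * (y - t * y)
    = (1 + q * (1 - t)) * y `^ (- q) by field; rewrite gt_eqF.
by rewrite ler_pM2r.
Qed.

(** With [q = 1 / beta - 1], the tangent bound gives an increment of at least [q] times [w - w']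
    divided by the power [1 / beta] of [w]. As [w - w' <= 1] and [beta < 1], [w] is at most [1 + C]
    times the [beta]-th power of [w - w']; [1 + 3 * C] is a weaker constant. *)
Lemma implicit_step_growth beta C (w w' : R) : 0 < beta -> beta < 1 -> 0 < C ->
  0 < w' -> w' <= w -> w - w' <= 1 -> w' <= C * (w - w') `^ beta ->
  w `^ (- (1 / beta - 1)) + (1 / beta - 1) * (1 + 3 * C) `^ (- (1 / beta)) <=
  w' `^ (- (1 / beta - 1)).
Proof.
move=> b0 b1 C0 w'0 w'w D1 step; have w0 := lt_le_trans w'0 w'w.
have q0 : 0 < 1 / beta - 1 by rewrite subr_gt0 ltr_pdivlMr ?mul1r.
apply: le_trans (powRN_tangent w'0 w0 (ltW q0)).
rewrite lerD2l -mulrA ler_pM2l// subrK.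
(* Equality of [w] and [w'] would turn [step] into [w' <= 0]. *)
have D0 : 0 < w - w'.
  rewrite lt_neqAle subr_ge0 w'w andbT eq_sym; apply: contraTneq step => ->.
  by rewrite powR0 ?gt_eqF// mulr0 -ltNge.
have wD : w <= (1 + 3 * C) * (w - w') `^ beta.
  have : w - w' <= (w - w') `^ beta by apply: ger1_powR; rewrite ?D0//= ltW.
  have := powR_gt0 beta D0; nra.
have C31 : 0 < 1 + 3 * C by lra.
have {}wD : w `^ (1 / beta) <= (1 + 3 * C) `^ (1 / beta) * (w - w').
  have -> : w - w' = ((w - w') `^ beta) `^ (1 / beta).
    by rewrite -powRrM mulrCA divff ?gt_eqF// mulr1 powRr1// ltW.
  rewrite -powRM ?powR_ge0 ?(ltW C31)//.
  apply: ge0_ler_powR;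
    rewrite ?nnegrE ?mulr_ge0 ?powR_ge0 ?(ltW C31) ?(ltW w0)//.
  by rewrite invr_ge0 ltW.
rewrite !powRN [leRHS]mulrC ler_pdivlMr ?powR_gt0// [leLHS]mulrC.
by rewrite ler_pdivrMr ?powR_gt0// [leRHS]mulrC.
Qed.

(** The increments of [implicit_step_growth] are summed from [N0] on; before that, monotonicity
    alone compares [w N0] with the initial value. Positivity of [w n] matters because a negative
    power of 0 is 0 here. *)
Lemma implicit_recursion_growth beta C (w : nat -> R) :
  0 < beta -> beta < 1 -> 0 < C ->
  (forall n, 0 <= w n) -> (forall n, w n.+1 <= w n) ->
  (forall n, w n.+1 <= C * (w n - w n.+1) `^ beta) ->
  exists N0, forall n, (N0 <= n)%N -> 0 < w n ->
    w 0%N `^ (- (1 / beta - 1)) +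
      (n - N0)%:R * ((1 / beta - 1) * (1 + 3 * C) `^ (- (1 / beta))) <=
    w n `^ (- (1 / beta - 1)).
Proof.
move=> b0 b1 C0 w0 wS step.
have wdec : nonincreasing_seq w by apply/nonincreasing_seqP.
(* Eventually all terms are within 1/2 of the limit, so consecutive ones differ by less than 1. *)
have [N0 N0P] : exists N0, forall n, (N0 <= n)%N -> w n - w n.+1 <= 1.
  have /cvgrPdist_lt/(_ (1 / 2)) : cvgn w.
    by apply: nonincreasing_is_cvgn => //; exists 0 => _ [n _ <-].
  rewrite divr_gt0// => /(_ isT)[N0 _ N0P]; exists N0 => n Nn.
  have := N0P n Nn; have := N0P n.+1 (leqW Nn).
  by rewrite !ltr_norml => /andP[? ?] /andP[? ?]; lra.
have q0 : 0 < 1 / beta - 1 by rewrite subr_gt0 ltr_pdivlMr ?mul1r.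
exists N0 => n; elim: n => [|n IH].
  by rewrite leqn0 => /eqP-> _; rewrite subnn mul0r addr0.
rewrite leq_eqVlt => /orP[/eqP<- wN|].
  rewrite subnn mul0r addr0; apply: powRN_le => //; last exact: ltW.
  exact: wdec.
rewrite ltnS => Nn wn.
apply: le_trans (implicit_step_growth b0 b1 C0 wn (wS n) (N0P n Nn) (step n)).
set K := _ * (1 + 3 * C) `^ _ in IH *.
rewrite subSn// -natr1 [(_ + 1) * K]mulrDl [1 * K]mul1r addrA lerD2r.
by apply: IH => //; exact: lt_le_trans (wS n).
Qed.

Lemma decay_bound_ge0 beta C T (alpha0 : R) N0 t :
  0 <= decay_bound beta C T alpha0 N0 t.
Proof.
by rewrite /decay_bound; case: ifP => // _; rewrite mulr_ge0 ?powR_ge0.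
Qed.

Lemma decay_exponentE beta : beta < 1 ->
  beta / (2 * (beta - 1)) = - (beta / (2 * (1 - beta))).
Proof. by move=> b1; field; lra. Qed.

Lemma decay_rate_gt0 beta C : 0 < beta -> beta < 1 -> 0 < C ->
  0 < (1 / beta - 1) * (1 + 3 * C) `^ (- (1 / beta)).
Proof.
move=> b0 b1 C0; rewrite mulr_gt0 ?powR_gt0//; last by lra.
by rewrite subr_gt0 ltr_pdivlMr ?mul1r.
Qed.

Lemma decay_bound_gt0 beta C T (alpha0 : R) N0 t :
  0 < beta -> beta < 1 -> 0 < C -> 0 < T -> 0 < alpha0 ->
  (N0%:R + 1) * T <= t -> 0 < decay_bound beta C T alpha0 N0 t.
Proof.
move=> b0 b1 C0 T0 a0 tN; rewrite /decay_bound gt_eqF// mulr_gt0// powR_gt0//.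
rewrite ltr_wpDl ?powR_gt0// -mulrA mulr_ge0 ?(ltW (decay_rate_gt0 b0 b1 C0))//.
by rewrite -addrA -opprD subr_ge0 ler_pdivlMr.
Qed.

Lemma decay_bound_le beta C T (alpha0 : R) N0 s t :
  0 < beta -> beta < 1 -> 0 < C -> 0 < T -> 0 <= alpha0 ->
  (N0%:R + 1) * T <= s -> s <= t ->
  decay_bound beta C T alpha0 N0 t <= decay_bound beta C T alpha0 N0 s.
Proof.
move=> b0 b1 C0 T0 a0 sN st; rewrite /decay_bound.
have [//|aN0] := eqVneq alpha0 0; rewrite ler_pM2l// decay_exponentE//.
have {aN0}a0 : 0 < alpha0 by rewrite lt_neqAle eq_sym aN0.
have K0 := decay_rate_gt0 b0 b1 C0.
apply: powRN_le; last by rewrite divr_ge0//; lra.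
  rewrite ltr_wpDl ?powR_gt0// -mulrA mulr_ge0 ?(ltW K0)//.
  by rewrite -addrA -opprD subr_ge0 ler_pdivlMr.
rewrite lerD2r -!mulrA ler_pM2r// !lerD2r.
by rewrite ler_pM2r ?invr_gt0.
Qed.

(** The growth lemma is applied to the squares. With [q = 1 / beta - 1], the outer exponent
    [beta / (2 * (beta - 1))] equals [- 1 / (2 * q)] and recovers [s n] from the power [- q] of
    [s n ^+ 2]. *)
Lemma implicit_recursion_decay beta C T (alpha0 : R) (s : nat -> R) :
  0 < beta -> beta < 1 -> 0 < C -> 0 < T ->
  s 0%N <= alpha0 -> (forall n, 0 <= s n) -> (forall n, s n.+1 <= s n) ->
  (forall n, s n.+1 ^+ 2 <= C * (s n ^+ 2 - s n.+1 ^+ 2) `^ beta) ->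
  exists N0, forall n, (N0 <= n)%N ->
    2 * s n <= decay_bound beta C T alpha0 N0 (n.+1%:R * T).
Proof.
move=> b0 b1 C0 T0 sa s0 sS step.
have [|||N0 N0P] :=
  @implicit_recursion_growth beta C (fun n => s n ^+ 2) b0 b1 C0.
- by move=> n; exact: sqr_ge0.
- by move=> n; rewrite ler_sqr ?nnegrE.
- exact: step.
exists N0 => n Nn; have [->|snN0] := eqVneq (s n) 0.
  by rewrite mulr0 decay_bound_ge0.
have sn : 0 < s n by rewrite lt_neqAle eq_sym snN0 s0.
have sn2 : 0 < s n ^+ 2 by rewrite exprn_gt0.
have s00 : 0 < s 0%N.
  by apply: lt_le_trans sn _; elim: (n) => // k; apply: le_trans.
have a0 : 0 < alpha0 := lt_le_trans s00 sa.
rewrite /decay_bound gt_eqF// ler_pM2l//.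
set q := 1 / beta - 1 in N0P *.
have q0 : 0 < q by rewrite subr_gt0 ltr_pdivlMr ?mul1r.
set K := (1 + 3 * C) `^ _ in N0P *.
(* The bound is taken at the right end of the [n]-th time interval, where it is smallest; this
   absorbs the [- 1] of the formula. *)
have -> : n.+1%:R * T / T - N0%:R - 1 = (n - N0)%:R.
  by rewrite mulfK ?gt_eqF// natrB// -natr1; ring.
have -> : alpha0 `^ (2 * (beta - 1) / beta) = (alpha0 ^+ 2) `^ (- q).
  rewrite -powR_mulrn ?(ltW a0)// -powRrM; congr (_ `^ _).
  by rewrite /q; field; rewrite gt_eqF.
have -> : s n = ((s n ^+ 2) `^ (- q)) `^ (beta / (2 * (beta - 1))).
  rewrite -powR_mulrn ?(ltW sn)// -!powRrM -[LHS]powRr1 ?(ltW sn)//.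
  by congr (_ `^ _); rewrite /q; field; apply/andP; split; lra.
rewrite decay_exponentE//; apply: powRN_le; last by rewrite divr_ge0//; lra.
  rewrite ltr_wpDl ?powR_gt0 ?exprn_gt0//.
  by rewrite !mulr_ge0 ?powR_ge0 ?(ltW q0).
apply: le_trans (N0P n Nn sn2); rewrite -mulrA [leRHS]addrC lerD2l.
apply: powRN_le; rewrite ?exprn_gt0 ?(ltW q0)//.
by rewrite ler_sqr ?nnegrE ?(ltW a0).
Qed.

End PolynomialDecay.

(** * Comparison of the bound with a pure power of time *)

Section PolynomialRate.
Context {R : realType}.
Implicit Types (beta C T : R).

(** Dropping the power of [alpha0] from the base leaves a multiple of [t - (N0%:R + 1) * T];
    strictness keeps it positive, so that the negative exponent reverses the inequality. *)
Lemma decay_bound_le_power beta C T (alpha0 : R) N0 t :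
  0 < beta -> beta < 1 -> 0 < C -> 0 < T -> 0 <= alpha0 ->
  (N0%:R + 1) * T < t ->
  decay_bound beta C T alpha0 N0 t <=
    2 * ((1 / beta - 1) * (1 + 3 * C) `^ (- (1 / beta)) / T)
      `^ (- (beta / (2 * (1 - beta)))) *
    (t - (N0%:R + 1) * T) `^ (- (beta / (2 * (1 - beta)))).
Proof.
move=> b0 b1 C0 T0 a0 tN; rewrite /decay_bound.
case: ifP => [_|/negbT aN0]; first by rewrite !mulr_ge0 ?powR_ge0.
have K0 := decay_rate_gt0 b0 b1 C0.
have KT0 : 0 < (1 / beta - 1) * (1 + 3 * C) `^ (- (1 / beta)) / T.
  by rewrite divr_gt0.
have tN0 : 0 < t - (N0%:R + 1) * T by rewrite subr_gt0.
rewrite decay_exponentE// -[leRHS]mulrA ler_pM2l//.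
rewrite -powRM ?(ltW KT0) ?(ltW tN0)//.
apply: powRN_le; first exact: mulr_gt0.
- rewrite [leLHS](_ : _ = (t / T - N0%:R - 1) * (1 / beta - 1) *
    (1 + 3 * C) `^ (- (1 / beta))); first by rewrite lerDl powR_ge0.
  by field; rewrite !gt_eqF.
- by rewrite divr_ge0 ?ltW//; lra.
Qed.

Lemma cvg_powRN (c q : R) : 0 < q -> c * t `^ (- q) @[t --> +oo] --> (0 : R).
Proof.
move=> q0; rewrite -[X in _ --> X](mulr0 c); apply: cvgMl_tmp.
apply/cvgrPdist_lt => e e0; near=> t.
have t0 : 0 < t by near: t; exact: nbhs_pinfty_gt.
rewrite sub0r normrN ger0_norm ?powR_ge0// powRN.
rewrite -[ltRHS]invrK ltf_pV2 ?posrE ?invr_gt0 ?powR_gt0//.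
(* Writing [e^-1] as a [q]-th power reduces the claim to a lower bound on [t]. *)
rewrite -[ltLHS]powRr1 ?invr_ge0 ?(ltW e0)// -(@mulVf _ q) ?gt_eqF// powRrM.
apply: gt0_ltr_powR => //; rewrite ?nnegrE ?powR_ge0 ?(ltW t0)//.
Unshelve. all: by end_near. Qed.

End PolynomialRate.

(** * Construction of compact attracting sets *)

Section Attractors.
Context {R : realType} {X : metricType R}.
Implicit Types (A B : set X) (S : R -> X -> X).

Lemma semidist_le A B (r : R) :
  (forall a, A a -> exists2 b, B b & mdist a b <= r) ->
  (semidist A B <= r%:E)%E.
Proof.
move=> AB; apply: ge_ereal_sup => _ [a /AB[b Bb ab] <-].
apply: (@le_trans _ _ (mdist a b)%:E); last by rewrite lee_fin.
by apply: ereal_inf_lbound; exists b.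
Qed.

Lemma semidistS A A' B : A `<=` A' -> (semidist A B <= semidist A' B)%E.
Proof.
by move=> AA'; apply: le_ereal_sup => _ [a Aa <-]; exists a => //; exact: AA'.
Qed.

Lemma image_later S A (s t : R) :
  dynamical_system S -> positively_invariant S A ->
  0 <= s -> s <= t -> S t @` A `<=` S s @` A.
Proof.
move=> dsS PI s0 st _ [x Ax <-].
have ts0 : 0 <= t - s by rewrite subr_ge0.
exists (S (t - s) x); first by apply: (PI _ ts0); exists x.
by rewrite -(ds_semigroup dsS)// addrC subrK.
Qed.

Lemma positively_invariant_image S A (s : R) : dynamical_system S ->
  positively_invariant S A -> 0 <= s -> positively_invariant S (S s @` A).
Proof.
move=> dsS PI s0 t t0 _ [_ [x Ax <-] <-].
exists (S t x); first by apply: (PI _ t0); exists x.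
by rewrite -!(ds_semigroup dsS)// addrC.
Qed.

Lemma positively_invariant_closure S A : dynamical_system S ->
  positively_invariant S A -> positively_invariant S (closure A).
Proof.
move=> dsS PI t t0 _ [x clx <-] W /(ds_continuous dsS t0)/clx[y [Ay Wy]].
by exists (S t y); split=> //; apply: (PI _ t0); exists y.
Qed.

Definition forward_orbit S (x : X) : set X :=
  [set S t x | t in [set t | 0 <= t]].

Lemma positively_invariant_orbits S A : dynamical_system S ->
  positively_invariant S (\bigcup_(x in A) forward_orbit S x).
Proof.
move=> dsS s s0 _ [_ [x Ax [t /= t0 <-]] <-]; exists x => //.
by exists (s + t); [exact: addr_ge0|exact: (ds_semigroup dsS)].
Qed.

Lemma orbit_segment_totally_bounded S (x : X) (t : R) : dynamical_system S ->
  totally_bounded ((fun s => S s x) @` `[0, t]).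
Proof.
move=> dsS; apply/compact_totally_bounded/continuous_compact.
  apply: continuous_subspaceW (@ds_time_continuous _ _ _ dsS x) => s /=.
  by rewrite in_itv /= => /andP[].
exact: segment_compact.
Qed.

(* Up to a ball of radius [r], all orbits have entered one [S (N T) B0] by time
   [N T]; only finitely many compact forward_orbit segments remain. *)
Lemma orbits_of_nets_totally_bounded S B0 (T : R) (E : nat -> seq X) :
  dynamical_system S -> positively_invariant S B0 -> 0 <= T ->
  (forall n e, e \in E n -> (S (n%:R * T) @` B0) e) ->
  (forall r, 0 < r -> exists n, covered_by_balls (S (n%:R * T) @` B0) r) ->
  totally_bounded
    (\bigcup_(x in [set x | exists n, x \in E n]) forward_orbit S x).
Proof.
move=> dsS PI T0 EB cov r r0; have [N NB] := cov r r0.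
have nT (n : nat) : 0 <= n%:R * T by rewrite mulr_ge0.
pose K := \bigcup_(n in [set` iota 0 N]) \bigcup_(x in [set` E n])
  (fun s => S s x) @` `[0, N%:R * T].
have cK : covered_by_balls K r.
  apply: covered_by_balls_bigcup => n _; apply: covered_by_balls_bigcup => x _.
  exact: orbit_segment_totally_bounded.
apply: covered_by_ballsS (lexx r) (covered_by_ballsU NB cK).
move=> _ [x /= [n xn] [t /= t0 <-]].
have [Nn|nN] := leqP N n.
  left; apply: (positively_invariant_image dsS PI (nT N) t0); exists x => //.
  apply: (image_later dsS PI (nT N)) (EB _ _ xn).
  by rewrite ler_wpM2r// ler_nat.
have [tN|/ltW Nt] := leP t (N%:R * T).
  right; exists n; first by rewrite /= mem_iota.
  by exists x => //; exists t => //=; rewrite in_itv /= t0.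
left; apply: (image_later dsS PI (nT N) Nt); exists x => //.
by have [b Bb <-] := EB _ _ xn; apply: (PI _ (nT n)); exists b.
Qed.

(** The net of step [n] has scale [rate (n.+1%:R * T)]: between the times [n%:R * T] and
    [n.+1%:R * T] the image of [B0] stays in the step [n] image, and [rate] is at least that scale.
    Whole orbits of net points are taken for positive invariance. *)
Lemma attracting_compact_set S B0 (T : R) (N : nat) (rate : R -> R) :
  complete_metric X -> dynamical_system S -> positively_invariant S B0 ->
  metric_bounded B0 -> 0 < T ->
  (forall t, N%:R * T <= t -> 0 < rate t) ->
  (forall s t, N%:R * T <= s -> s <= t -> rate t <= rate s) ->
  rate @ +oo --> (0 : R) ->
  (forall n, (N <= n)%N ->
    separation (S (n%:R * T) @` B0) < rate (n.+1%:R * T)) ->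
  exists A, [/\ compact A, positively_invariant S A &
    forall t, N%:R * T <= t -> (semidist (S t @` B0) A <= (rate t)%:E)%E].
Proof.
move=> Xc dsS PI bB0 T0 rate0 rateS ratec sepr.
have nT (n : nat) : 0 <= n%:R * T by rewrite mulr_ge0// ltW.
have nTS (n : nat) : n%:R * T <= n.+1%:R * T by rewrite ler_pM2r// ler_nat.
have bA n : metric_bounded (S (n%:R * T) @` B0).
  exact: metric_boundedS (PI _ (nT n)) bB0.
have net n : (N <= n)%N -> finite_net (S (n%:R * T) @` B0) (rate (n.+1%:R * T)).
  by move=> Nn; apply/finite_netP/separation_gt => //; exact: sepr.
have /choice[E EP] : forall n, exists s : seq X,
    (forall e, e \in s -> (S (n%:R * T) @` B0) e) /\
    ((N <= n)%N -> forall x, (S (n%:R * T) @` B0) x ->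
      exists2 y, y \in s & mdist y x < rate (n.+1%:R * T)).
  move=> n; have [Nn|nN] := leqP N n; last by exists [::].
  by have [s sA sP] := net n Nn; exists s.
pose U := \bigcup_(x in [set x | exists n, x \in E n]) forward_orbit S x.
have tU : totally_bounded U.
  apply: (orbits_of_nets_totally_bounded dsS PI (ltW T0)) => [n|r r0].
    exact: (EP n).1.
  have [n [Nn nr]] : exists n, (N <= n)%N /\ rate (n.+1%:R * T) < r.
    have /filter_ex : \forall n \near \oo, (N <= n)%N /\ rate (n.+1%:R * T) < r.
      have /cvgr_lt/(_ _ r0)[M [_ MP]] := ratec.
      near=> n; split; first by near: n; exact: nbhs_infty_ge.
      apply: MP; rewrite -ltr_pdivrMr//.
      apply: lt_le_trans (_ : n%:R <= _); last by rewrite ler_nat.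
      by near: n; exact: nbhs_infty_gtr.
    exact.
  exists n; apply: covered_by_ballsS (@subset_refl _ _) (ltW nr) _.
  exact/finite_net_covered/net.
exists (closure U); split.
- exact: complete_totally_bounded_compact.
- exact/positively_invariant_closure/positively_invariant_orbits.
- move=> t tN; apply: semidist_le => x xt.
  have t0 : 0 <= t / T by rewrite divr_ge0 ?(ltW T0)// (le_trans _ tN).
  have /andP[nt tn] := truncn_itv t0.
  set n := Num.truncn (t / T) in nt tn.
  move: nt tn; rewrite ler_pdivlMr// ltr_pdivrMr// => nt tn.
  have Nn : (N <= n)%N.
    by rewrite -ltnS -(ltr_nat R) -(ltr_pM2r T0) (le_lt_trans tN).
  have [y yE yx] := (EP n).2 Nn x (image_later dsS PI (nT n) nt xt).
  exists y; last first.
    by rewrite metric_sym (le_trans (ltW yx))// rateS// ltW.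
  apply: subset_closure; exists y; first by exists n.
  by exists 0; [rewrite /=|exact: (ds_id dsS)].
Unshelve. all: by end_near. Qed.

(** This serves the degenerate case [kuratowski B0 = 0], where the decay bound is 0 and gives no
    positive scale for nets. *)
Lemma attracting_precompact_set S B0 :
  complete_metric X -> dynamical_system S ->
  positively_invariant S B0 -> totally_bounded B0 ->
  exists A, [/\ compact A, positively_invariant S A &
    forall t, 0 <= t -> (semidist (S t @` B0) A <= 0)%E].
Proof.
move=> Xc dsS PI tB0; exists (closure B0); split.
- exact: complete_totally_bounded_compact.
- exact: positively_invariant_closure.
- move=> t t0; apply: semidist_le => x /(PI _ t0) Bx.
  by exists x; [exact: subset_closure|rewrite mdistxx].
Qed.

Lemma image_entering S A B (tB t : R) : dynamical_system S ->
  entering_time S A B tB -> tB <= t -> S t @` B `<=` S (t - tB) @` A.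
Proof.
move=> dsS [tB0 BA] tBt _ [x Bx <-]; exists (S tB x).
  by apply: (BA _ (lexx _)); exists x.
by rewrite -(ds_semigroup dsS) ?subr_ge0// subrK.
Qed.

End Attractors.

(** * Vanishing of the bound at infinity, and assembly of the estimates *)

Lemma cvg_decay_bound {R : realType} (beta C T alpha0 : R) N0 :
  0 < beta -> beta < 1 -> 0 < C -> 0 < T -> 0 <= alpha0 ->
  decay_bound beta C T alpha0 N0 @ +oo --> (0 : R).
Proof.
move=> b0 b1 C0 T0 a0; have q0 : 0 < beta / (2 * (1 - beta)).
  by rewrite divr_gt0//; lra.
set K := (1 / beta - 1) * (1 + 3 * C) `^ (- (1 / beta)) / T.
have /cvgr_lt c := @cvg_powRN _ (2 * K `^ (- (beta / (2 * (1 - beta))))) _ q0.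
apply/cvgrPdist_lt => e /c[M [_ MP]]; near=> t.
have tN : (N0%:R + 1) * T < t.
  by near: t; apply: nbhs_pinfty_gt; exact: num_real.
have tM : M < t - (N0%:R + 1) * T.
  by rewrite ltrBrDr; near: t; apply: nbhs_pinfty_gt; exact: num_real.
rewrite sub0r normrN ger0_norm ?decay_bound_ge0//.
by apply: le_lt_trans (MP _ tM); exact: decay_bound_le_power.
Unshelve. all: by end_near. Qed.

Theorem theorem2p4 (R : realType) (X : metricType R)
    (X_complete : complete_metric X)
    (S : R -> X -> X)
    (S_ds : dynamical_system S)
    (S_dissipative : dissipative S)
    (B0 : set X)
    (B0_invariant : positively_invariant S B0)
    (B0_bounded : metric_bounded B0)
    (B0_absorbing : absorbing S B0)
    (beta C T : R)
    (beta_gt0 : 0 < beta) (beta_lt1 : beta < 1) (C_gt0 : 0 < C) (T_gt0 : 0 < T)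
    (m : nat) (m_gt0 : (0 < m)%N)
    (g1 g2 : 'rV[R]_m -> R)
    (Psi1 Psi2 : X -> X -> R)
    (rho : 'I_m -> X -> X -> R)
    (rho_pseudometric : forall i, pseudometric_on B0 (rho i))
    (g1_ge0 : nonneg_on_orthant g1)
    (g2_ge0 : nonneg_on_orthant g2)
    (g1_nondecreasing : nondecreasing_each_variable g1)
    (g2_nondecreasing : nondecreasing_each_variable g2)
    (g1_0 : g1 0 = 0)
    (g2_0 : g2 0 = 0)
    (g1_continuous : continuous_at_origin g1)
    (g2_continuous : continuous_at_origin g2)
    (rho_precompact : forall i, precompact_on B0 (rho i))
    (Psi1_contr : Contr B0 Psi1)
    (Psi2_contr : Contr B0 Psi2)
    (ineq1 : forall y1 y2, B0 y1 -> B0 y2 ->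
      mdist (S T y1) (S T y2) ^+ 2 <=
        mdist y1 y2 ^+ 2 + g1 (eval_pseudometrics rho y1 y2) + Psi1 y1 y2)
    (ineq2 : forall y1 y2, B0 y1 -> B0 y2 ->
      mdist (S T y1) (S T y2) ^+ 2 <=
        C * (mdist y1 y2 ^+ 2 - mdist (S T y1) (S T y2) ^+ 2
             + g1 (eval_pseudometrics rho y1 y2) + Psi1 y1 y2) `^ beta
        + g2 (eval_pseudometrics rho y1 y2) + Psi2 y1 y2) :
  exists N0 : nat,
    (forall t, (N0%:R + 1) * T <= t ->
       kuratowski (S t @` B0) <= decay_bound beta C T (kuratowski B0) N0 t) /\
    exists Astar : set X,
      generalized_polynomial_attractor S Astar /\
      forall (B : set X) (tB : R),
        metric_bounded B -> entering_time S B0 B tB ->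
        forall t, (N0%:R + 1) * T + tB + 1 <= t ->
          (semidist (S t @` B) Astar <=
           (decay_bound beta C T (kuratowski B0) N0 (t - tB - 1))%:E)%E.

Proof.
have a0 := kuratowski_ge0 B0_bounded.
have T0 := ltW T_gt0.
have nT (n : nat) : 0 <= n%:R * T by rewrite mulr_ge0.
pose A n := S (n%:R * T) @` B0.
have AB n : A n `<=` B0 by exact: B0_invariant.
have bA n : metric_bounded (A n) := metric_boundedS (AB n) B0_bounded.
have AS n : A n.+1 = S T @` A n.
  rewrite /A image_comp; congr (_ @` _); apply/funext => x /=.
  by rewrite -(ds_semigroup S_ds)// -natr1 mulrDl mul1r addrC.
have ASA n : S T @` A n `<=` A n.
  by apply: (positively_invariant_image S_ds B0_invariant (nT n)).
have [N0 N0P] : exists N0, forall n, (N0 <= n)%N -> 2 * separation (A n) <=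
    decay_bound beta C T (kuratowski B0) N0 (n.+1%:R * T).
  apply: implicit_recursion_decay => // [||n|n].
  - apply: le_trans (separation_le_kuratowski B0_bounded).
    exact: separationS.
  - by move=> n; exact: separation_ge0.
  - by rewrite AS; exact: separationS.
  - rewrite AS; exact: (separation_image_step beta_gt0 C_gt0 rho_pseudometric
      g1_0 g2_0 g1_continuous g2_continuous rho_precompact Psi1_contr
      Psi2_contr ineq1 ineq2).
set decay := decay_bound beta C T (kuratowski B0) N0 in N0P *.
have decayS s t : (N0%:R + 1) * T <= s -> s <= t -> decay t <= decay s.
  exact: decay_bound_le.
exists N0; split=> [t tN|].
  have t0 : 0 <= t / T by rewrite divr_ge0// (le_trans _ tN)// mulr_ge0.
  have /andP[nt tn] := truncn_itv t0.
  (* With [n] the integer part of [t / T], [S t] maps [B0] into [A n], and the bound at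
     [n.+1%:R * T] is at most that at [t]. *)
  set n := Num.truncn (t / T) in nt tn.
  move: nt tn; rewrite ler_pdivlMr// ltr_pdivrMr// => nt tn.
  have Nn : (N0 <= n)%N.
    rewrite -ltnS ltnW// -(ltr_nat R) -(ltr_pM2r T_gt0).
    by apply: le_lt_trans tn; rewrite -natr1.
  apply: le_trans (decayS _ _ tN (ltW tn)); apply: le_trans (N0P n Nn).
  apply: le_trans (kuratowski_le_separation (bA n)).
  by apply: kuratowskiS => //; exact: image_later.
have [Astar [cA PIA attr]] : exists A, [/\ compact A, positively_invariant S A &
    forall t, (N0%:R + 1) * T <= t ->
      (semidist (S t @` B0) A <= (decay t)%:E)%E].
  have [alpha0|alphaN0] := eqVneq (kuratowski B0) 0.
    have tB0 : totally_bounded B0.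
      move=> r r0; apply/finite_net_covered/finite_netP/separation_gt => //.
      by rewrite (le_lt_trans (separation_le_kuratowski _))// alpha0.
    have [A' [cA PIA attr]] :=
      attracting_precompact_set X_complete S_ds B0_invariant tB0.
    exists A'; split=> // t tN; apply: le_trans (attr t _) _.
      by rewrite (le_trans _ tN)// mulr_ge0.
    by rewrite lee_fin decay_bound_ge0.
  have alpha0 : 0 < kuratowski B0 by rewrite lt_neqAle eq_sym alphaN0.
  rewrite natr1; apply: attracting_compact_set => //.
  - by move=> t; rewrite -natr1; exact: decay_bound_gt0.
  - by move=> s t; rewrite -natr1; exact: decayS.
  - exact: cvg_decay_bound.
  - move=> n Nn.
    (* Positivity of the bound turns [2 * separation (A n) <= decay (n.+1%:R * T)] into the strict
       inequality needed for nets, even if the separation constant is 0. *)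
    have d0 : 0 < decay (n.+1%:R * T).
      apply: decay_bound_gt0 => //.
      by rewrite natr1 ler_pM2r// ler_nat (leq_trans Nn).
    by have := N0P n (ltnW Nn); rewrite -/(A n); lra.
have attrB B tB : entering_time S B0 B tB ->
    forall t, (N0%:R + 1) * T + tB + 1 <= t ->
    (semidist (S t @` B) Astar <= (decay (t - tB - 1))%:E)%E.
  move=> Bt t tN; have NT : 0 <= (N0%:R + 1) * T by rewrite mulr_ge0.
  have ts : (N0%:R + 1) * T <= t - tB - 1 by lra.
  apply: le_trans (attr _ ts); apply: semidistS.
  (* The image of [B] lies in that of [B0] at time [t - tB], hence also in that at the earlier time
     [t - tB - 1]. *)
  apply: subset_trans (image_entering S_ds Bt _) _; first by lra.
  by apply: (image_later S_ds B0_invariant); lra.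
exists Astar; split; last by move=> B tB _; exact: attrB.
have b2 : 0 < beta / (2 * (1 - beta)) by rewrite divr_gt0//; lra.
pose K := (1 / beta - 1) * (1 + 3 * C) `^ (- (1 / beta)) / T.
pose C' := 2 * K `^ (- (beta / (2 * (1 - beta)))).
have C'0 : 0 < C'.
  by rewrite mulr_gt0 ?powR_gt0// divr_gt0// decay_rate_gt0.
exists C', (beta / (2 * (1 - beta))),
  (fun t => C' * t `^ (- (beta / (2 * (1 - beta))))); split=> //.
split=> //; first split.
- by move=> t _; rewrite mulr_ge0 ?powR_ge0// ltW.
- exact: cvg_powRN.
exists 1 => B /B0_absorbing[tB Bt].
have tB0 : 0 <= tB by case: Bt.
(* With [t0 = 1], this makes the argument of [phi] equal to [t - tB - 1 - (N0%:R + 1) * T], as in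
   [decay_bound_le_power]; it is at least 1, hence away from the singularity at 0. *)
exists ((N0%:R + 1) * T + tB + 2).
  by rewrite !addr_ge0// mulr_ge0.
move=> t tN; split; first by lra.
apply: le_trans (attrB _ _ Bt t _) _; first by lra.
rewrite lee_fin.
have -> : t + 1 - ((N0%:R + 1) * T + tB + 2) = t - tB - 1 - (N0%:R + 1) * T.
  by ring.
by apply: decay_bound_le_power => //; lra.
Qed.
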